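(* Let $\mu>0$, $P_0=N(0,1)$ and $P_\mu=N(\mu,1)$ on $(\mathbb{R},\mathcal B_{\mathbb R})$, and let $\mathcal G=\sigma([n,n+1):n\in\mathbb{Z})$. Then $$T(P_0,P_\mu)(\alpha)=\Phi(\Phi^{-1}(1-\alpha)-\mu)\quad\text{for all }\alpha\in[0,1].$$ Moreover, with $\alpha_k:=1-\Phi(k)$ for $k\in\mathbb{Z}$, $$T_{\mathcal G}(P_0,P_\mu)(\alpha_k)=\Phi(\Phi^{-1}(1-\alpha_k)-\mu)\quad\text{for all }k\in\mathbb{Z},$$ and for all $k\in\mathbb{Z}$ and all $\alpha\in[\alpha_{k+1},\alpha_k]$, $$T_{\mathcal G}(P_0,P_\mu)(\alpha)=T_{\mathcal G}(P_0,P_\mu)(\alpha_{k+1})-\lambda^*q_k,\qquad \lambda^*=\frac{\alpha-\alpha_{k+1}}{\alpha_k-\alpha_{k+1}},\quad q_k=\Phi(k+1-\mu)-\Phi(k-\mu).$$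
   Context: $\Phi$ is the standard normal cumulative distribution function, with the conventions $\Phi^{-1}(0)=-\infty$, $\Phi^{-1}(1)=+\infty$, $\Phi(-\infty)=0$, $\Phi(+\infty)=1$. For probability measures $P,Q$ on a measurable space $(\Omega,\mathcal F)$, the trade-off function $T(P,Q):[0,1]\to[0,1]$ is $$T(P,Q)(\alpha)=\inf\{\mathbb{E}_Q[1-\varphi] : \varphi:(\Omega,\mathcal F)\to[0,1]\text{ measurable},\ \mathbb{E}_P[\varphi]\le\alpha\}.$$ For a sub-$\sigma$-algebra $\mathcal G\subseteq\mathcal F$, the coarsened trade-off function $T_{\mathcal G}(P,Q)$ is defined by the same formula with the infimum restricted to $\mathcal G$-measurable $\varphi:\Omega\to[0,1]$. *)

(* Defs.v *)
From HB Require Import structures.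
From mathcomp Require Import all_boot all_order all_algebra.
From mathcomp Require Import all_classical all_reals all_analysis.

Set Implicit Arguments.
Unset Strict Implicit.
Unset Printing Implicit Defensive.

Import Order.TTheory GRing.Theory Num.Theory.
Import numFieldNormedType.Exports.

Local Open Scope classical_set_scope.
Local Open Scope ring_scope.

(* The infimum is taken in [\bar R]: an equation with a finite right-hand side
   therefore also asserts that the infimum is finite. *)
Definition tradeoff_over d (T : measurableType d) (R : realType)
    (M : set (T -> R)) (P Q : probability T R) (alpha : R) : \bar R :=
  ereal_inf [set 'E_Q[fun x => (1 - phi x)%R]%E | phi in
    [set phi | [/\ M phi, forall x, 0 <= phi x <= 1
                 & ('E_P[phi] <= alpha%:E)%E]]].

Definition tradeoff d (T : measurableType d) (R : realType)
    (P Q : probability T R) (alpha : R) : \bar R :=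
  tradeoff_over [set phi : T -> R | measurable_fun [set: T] phi] P Q alpha.

(* [g_sigma_algebraType G] is [T] with measurable sets [<<s G >>], which is [G]
   itself when [G] is a sigma-algebra, the only intended use. *)
Definition coarse_tradeoff d (T : measurableType d) (R : realType)
    (G : set (set T)) (P Q : probability T R) (alpha : R) : \bar R :=
  tradeoff_over
    [set phi : T -> R | measurable_fun [set: g_sigma_algebraType G]
                          (phi : g_sigma_algebraType G -> R)] P Q alpha.

Definition gauss (R : realType) (m : R) : probability (measurableTypeR R) R :=
  normal_prob m 1.

Definition Phi (R : realType) (x : \bar R) : R :=
  match x with
  | r%:E => fine (gauss (0 : R) `]-oo, r]%classic)
  | +oo%E => 1
  | -oo%E => 0
  end.

(* Meaningful for [0 <= p <= 1] only; for [0 < p < 1] the real [x] with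
   [Phi x = p] exists and is unique. *)
Definition Phi_inv (R : realType) (p : R) : \bar R :=
  if p == 0 then -oo%E
  else if p == 1 then +oo%E
  else (xget 0 [set x : R | Phi x%:E = p])%:E.

Definition unit_cells_algebra (R : realType) : set (set (measurableTypeR R)) :=
  <<s [set `[(n%:~R : R), (n + 1)%:~R[%classic | n in [set: int]] >>.
Arguments unit_cells_algebra : clear implicits.

Lemma unit_cells_algebra_sub (R : realType) :
  sigma_algebra setT (unit_cells_algebra R) /\
  unit_cells_algebra R `<=` measurable.
Proof.
split; first exact: smallest_sigma_algebra.
apply: smallest_sub; first exact: sigma_algebra_measurable.
by move=> _ [n _ <-]; exact: measurable_itv.
Qed.

(* Main.v *)
(* Neyman-Pearson: the law N(mu,1) has the increasing density
   x |-> exp (mu * x - mu ^ 2 / 2) with respect to N(0,1), so half-lines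
   [t, +oo) are optimal rejection regions. A test measurable for the unit cells
   is constant on each cell, hence optimality only needs comparing
   the density with the ratio of the masses of the k-th cell, outside this
   cell: the optimal test rejects on [k+1, +oo), and with probability lambda on
   [k, k+1). *)

Require Import Defs.
From HB Require Import structures.
From mathcomp Require Import all_boot all_order all_algebra.
From mathcomp Require Import all_classical all_reals all_analysis.
From mathcomp Require Import measurable_realfun ring lra.

Import Order.TTheory GRing.Theory Num.Theory.
Import numFieldNormedType.Exports.
Local Open Scope classical_set_scope.
Local Open Scope ring_scope.

(** * Randomized tests and an abstract Neyman-Pearson lemma *)

Section tests.
Context {d : measure_display} {T : measurableType d} {R : realType}.
Implicit Types (P Q : probability T R) (f phi : T -> R) (D A : set T).

(** Domination is known only for subsets of [D], so both measures are first restricted to [D], where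
    it becomes global. *)
Lemma le_measure_integral_on (m1 m2 : {measure set T -> \bar R}) (D : set T)
    (f : T -> \bar R) : measurable D ->
  (forall A, measurable A -> A `<=` D -> (m1 A <= m2 A)%E) ->
  (forall x, (0 <= f x)%E) -> measurable_fun setT f ->
  (\int[m1]_(x in D) f x <= \int[m2]_(x in D) f x)%E.
Proof.
move=> mD m12 f0 mf.
have restr (m : {measure set T -> \bar R}) :
    (\int[m]_(x in D) f x = \int[mrestr m mD]_(x in D) f x)%E.
  apply: eq_measure_integral => A mA /setIidPl AD.
  by rewrite /= /mrestr AD.
rewrite (restr m1) (restr m2); apply: ge0_le_measure_integral => // A mA.
by apply: m12; [exact: measurableI|exact: subIsetr].
Qed.

Lemma test_integrable P D phi : measurable D -> measurable_fun setT phi ->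
  (forall x, 0 <= phi x <= 1) -> P.-integrable D (EFin \o phi).
Proof.
move=> mD mphi phi01; apply: measurable_bounded_integrable => //.
- by rewrite (le_lt_trans (probability_le1 P mD))// ltry.
- exact: measurable_funTS.
- exists 1; split => // x x1 t _ /=.
  rewrite ger0_norm; case/andP: (phi01 t) => //.
  by move=> _ /le_trans; apply; exact: ltW.
Qed.

Lemma test_compl_Rintegral P D phi : measurable D -> measurable_fun setT phi ->
  (forall x, 0 <= phi x <= 1) ->
  \int[P]_(x in D) (1 - phi x) = fine (P D) - \int[P]_(x in D) phi x.
Proof.
move=> mD mphi phi01; rewrite RintegralB//.
- by rewrite Rintegral_cst// mul1r.
- by apply: test_integrable => // x; rewrite ler01 lexx.
- exact: test_integrable.
Qed.

Lemma test_expectation P phi : measurable_fun setT phi ->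
  (forall x, 0 <= phi x <= 1) -> 'E_P[phi]%E = (\int[P]_x phi x)%:E.
Proof.
move=> mphi phi01; rewrite unlock /Rintegral fineK//.
by apply: integrable_fin_num => //; exact: test_integrable.
Qed.

(** Moves the constants into scaled measures, so that a comparison of sets becomes one of integrals.
    Constants on both sides let it serve [c P <= Q] and [Q <= c P] alike. *)
Lemma test_Rintegral_le P Q D (c1 c2 : {nonneg R}) phi : measurable D ->
  measurable_fun setT phi -> (forall x, 0 <= phi x <= 1) ->
  (forall A, measurable A -> A `<=` D ->
    (c1%:num%:E * P A <= c2%:num%:E * Q A)%E) ->
  c1%:num * \int[P]_(x in D) phi x <= c2%:num * \int[Q]_(x in D) phi x.
Proof.
move=> mD mphi phi01 PQ.
have fin (S : probability T R) :
    (\int[S]_(x in D) (phi x)%:E)%E \is a fin_num.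
  by apply: integrable_fin_num => //; exact: test_integrable.
rewrite -lee_fin !EFinM /Rintegral !fineK ?fin//.
have phi0 x : (0 <= (phi x)%:E)%E by rewrite lee_fin; case/andP: (phi01 x).
have mphiE : measurable_fun setT (EFin \o phi) by exact/measurable_EFinP.
rewrite -!ge0_integral_mscale//; try exact: measurable_funTS.
exact: le_measure_integral_on.
Qed.

(* With [c] the critical likelihood ratio, [Q - c P] is nonnegative on the
   rejection region [U], nonpositive outside [U `|` W], and integrates to [0]
   over the randomization region [W], where tests are constant. *)
Lemma neyman_pearson_le P Q (U W : set T) (c : {nonneg R}) (v : R) phi :
  measurable U -> measurable W -> [disjoint U & W] ->
  (forall A, measurable A -> A `<=` U -> (c%:num%:E * P A <= Q A)%E) ->
  (forall A, measurable A -> A `<=` ~` (U `|` W) ->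
    (Q A <= c%:num%:E * P A)%E) ->
  fine (Q W) = c%:num * fine (P W) ->
  measurable_fun setT phi -> (forall x, 0 <= phi x <= 1) ->
  (forall x, W x -> phi x = v) ->
  \int[Q]_x phi x <=
    fine (Q U) + c%:num * (\int[P]_x phi x - fine (P U)).
Proof.
move=> mU mW UW QU QV QW mphi phi01 phiW.
have mUW : measurable (U `|` W) by exact: measurableU.
have split3 (S : probability T R) : \int[S]_x phi x =
    \int[S]_(x in U) phi x + v * fine (S W)
    + \int[S]_(x in ~` (U `|` W)) phi x.
  rewrite -(setUv (U `|` W)) Rintegral_setU//; last 3 first.
  - exact: measurableC.
  - apply: test_integrable => //.
    by apply: measurableU => //; exact: measurableC.
  - by apply/disj_set2P; rewrite setICr.
  rewrite Rintegral_setU//; last exact: test_integrable.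
  rewrite -Rintegral_cst//; congr (_ + _ + _).
  by apply: eq_Rintegral => x /[!inE]/phiW.
(* On [U] the best test equals 1, so [phi] is measured by its deficit [1 - phi]; outside [U] and [W]
   the best test is 0, so [phi] itself is the excess. *)
have : c%:num * \int[P]_(x in U) (1 - phi x) <=
    1%:nng%:num * \int[Q]_(x in U) (1 - phi x).
  apply: test_Rintegral_le => //.
  - exact: measurable_funB.
  - by move=> x; have /andP[? ?] := phi01 x; rewrite subr_ge0 gerBl; apply/andP.
  - by move=> A mA AU; rewrite /= mul1e; exact: QU.
have : 1%:nng%:num * \int[Q]_(x in ~` (U `|` W)) phi x <=
    c%:num * \int[P]_(x in ~` (U `|` W)) phi x.
  apply: test_Rintegral_le => //; first exact: measurableC.
  by move=> A mA AU; rewrite /= mul1e; exact: QV.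
rewrite !split3 !test_compl_Rintegral// QW /=.
set x := Rintegral P _ _; set y := Rintegral Q _ _.
set z := Rintegral P _ _; set t := Rintegral Q _ _.
(* The sum of the two inequalities; by [QW] the contributions [v * fine (Q W)] and
   [c * (v * fine (P W))] cancel. *)
nra.
Qed.

Lemma randomized_test_Rintegral P (U W : set T) (l : R) :
  measurable U -> measurable W -> 0 <= l <= 1 ->
  \int[P]_x (\1_U x + l * \1_W x) = fine (P U) + l * fine (P W).
Proof.
move=> mU mW l01.
have iU A : measurable A -> P.-integrable setT (EFin \o (\1_A : T -> R)).
  move=> mA; apply: test_integrable => //.
  by move=> x; rewrite indicE; case: (_ \in _); rewrite lexx ler01.
rewrite RintegralD//; first last.
- apply: test_integrable => //; first exact: measurable_funM.
  move=> x; rewrite indicE; case: (_ \in _); rewrite ?mulr1//.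
  by rewrite mulr0 lexx ler01.
- exact: iU.
rewrite RintegralZl//; last exact: iU.
by rewrite /Rintegral !integral_indic// !setIT.
Qed.

(** The class [M] is left abstract to cover both Borel tests, with [W] empty, and tests constant on
    cells, with [W] a cell. The infimum is attained at the test that is 1 on [U] and [l] on [W]. *)
Lemma neyman_pearson (M : set (T -> R)) P Q (U W : set T) (c : {nonneg R})
    (l : R) :
  measurable U -> measurable W -> [disjoint U & W] -> 0 <= l <= 1 ->
  (forall A, measurable A -> A `<=` U -> (c%:num%:E * P A <= Q A)%E) ->
  (forall A, measurable A -> A `<=` ~` (U `|` W) ->
    (Q A <= c%:num%:E * P A)%E) ->
  fine (Q W) = c%:num * fine (P W) ->
  (forall phi, M phi -> measurable_fun setT phi /\
    exists v, forall x, W x -> phi x = v) ->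
  M (fun x => \1_U x + l * \1_W x) ->
  tradeoff_over M P Q (fine (P U) + l * fine (P W)) =
    (1 - fine (Q U) - l * fine (Q W))%:E.
Proof.
move=> mU mW UW l01 QU QV QW hM MUW; set psi := fun x => _ + _ in MUW.
have psi01 x : 0 <= psi x <= 1.
  rewrite /psi !indicE; have [xU|_] := boolP (x \in U); last first.
    by rewrite add0r; case: (_ \in _); rewrite ?mulr1// mulr0 lexx ler01.
  have [xW|_] := boolP (x \in W); last by rewrite mulr0 addr0 lexx ler01.
  have : (U `&` W) x by split; exact/set_mem.
  by move/disj_set2P : UW => ->.
have E1 (S : probability T R) phi : measurable_fun setT phi ->
    (forall x, 0 <= phi x <= 1) ->
    'E_S[fun x => (1 - phi x)%R]%E = (1 - \int[S]_x phi x)%:E.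
  move=> mphi phi01; rewrite test_expectation//; first last.
  - by move=> x; have /andP[? ?] := phi01 x; rewrite subr_ge0 gerBl; apply/andP.
  - exact: measurable_funB.
  by rewrite test_compl_Rintegral// probability_setT.
apply/eqP; rewrite eq_le; apply/andP; split.
  apply: ereal_inf_lbound; exists psi.
    split => //; rewrite test_expectation//; last exact: (hM _ MUW).1.
    by rewrite lee_fin randomized_test_Rintegral.
  rewrite E1//; last exact: (hM _ MUW).1.
  by rewrite randomized_test_Rintegral// opprD addrA.
(* Lower bound: the level constraint on [phi] caps its power through [neyman_pearson_le], since [c]
   is nonnegative. *)
apply: le_ereal_inf_tmp => _ [phi [Mphi phi01 Ephi] <-].
have [mphi [v phiW]] := hM _ Mphi.
rewrite E1// lee_fin.
have := @neyman_pearson_le P Q U W c v phi mU mW UW QU QV QW mphi phi01 phiW.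
move: Ephi; rewrite test_expectation// lee_fin QW -!addrA lerD2l -opprD lerN2.
move=> Ephi /le_trans; apply; rewrite lerD2l mulrCA ler_wpM2l//.
by rewrite lerBlDl.
Qed.

Lemma tradeoff_over_le1 (M : set (T -> R)) P Q (alpha : R) :
M (cst 0) -> 0 <= alpha -> (tradeoff_over M P Q alpha <= 1)%E.
Proof.
move=> M0 alpha0; apply: ereal_inf_lbound; exists (cst 0).
  split => //; first by move=> x; rewrite lexx ler01.
  by rewrite expectation_cst lee_fin.
by under eq_fun do rewrite subr0; rewrite expectation_cst.
Qed.

Lemma tradeoff_over_antitone (M : set (T -> R)) P Q (alpha beta : R) :
  alpha <= beta ->
  (tradeoff_over M P Q beta <= tradeoff_over M P Q alpha)%E.
Proof.
move=> ab; apply: ereal_inf_le_tmp => _ [phi [Mphi phi01 Pphi] <-].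
by exists phi => //; split => //; apply: le_trans Pphi _; rewrite lee_fin.
Qed.

End tests.

(** * Gaussian densities, masses of intervals, and the bijection [Phi] *)

Section gaussian.
Context {R : realType}.
Implicit Types (m t : R) (A B : set (measurableTypeR R)).

Lemma normal_pdf1E m x :
  normal_pdf m 1 x = normal_peak 1 * expR (- (x - m) ^+ 2 / 2).
Proof.
by rewrite normal_pdfE ?oner_eq0// /normal_fun expr1n.
Qed.

(** The Radon-Nikodym derivative of N(m,1) with respect to N(0,1). *)
Definition likelihood_ratio m x := expR (m * x - m ^+ 2 / 2).

Lemma normal_pdf_likelihood_ratio m x :
  normal_pdf m 1 x = likelihood_ratio m x * normal_pdf 0 1 x.
Proof.
rewrite !normal_pdf1E mulrCA -expRD; congr (_ * expR _).
by field.
Qed.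

Lemma likelihood_ratio_gt0 m x : 0 < likelihood_ratio m x.
Proof. exact: expR_gt0. Qed.

Lemma le_likelihood_ratio m x y : 0 < m ->
  (likelihood_ratio m x <= likelihood_ratio m y) = (x <= y).
Proof. by move=> m0; rewrite ler_expR lerD2r ler_pM2l. Qed.

Lemma measurable_EFin_normal_pdf m (D : set R) :
  measurable_fun D (EFin \o normal_pdf m 1).
Proof.
by apply/measurable_EFinP/measurable_funTS; exact: measurable_normal_pdf.
Qed.

Lemma le_gauss m1 m2 (c1 c2 : R) A : measurable A -> 0 <= c1 -> 0 <= c2 ->
  (forall x, A x -> c1 * normal_pdf m1 1 x <= c2 * normal_pdf m2 1 x) ->
  (c1%:E * gauss m1 A <= c2%:E * gauss m2 A)%E.
Proof.
move=> mA c10 c20 c12; rewrite /gauss /= /normal_prob.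
have scale (c m : R) : 0 <= c ->
    (c%:E * \int[lebesgue_measure]_(x in A) (normal_pdf m 1 x)%:E =
     \int[lebesgue_measure]_(x in A) (c * normal_pdf m 1 x)%:E)%E.
  move=> c0; under [RHS]eq_integral do rewrite EFinM.
  rewrite ge0_integralZl//.
  - exact: measurable_EFin_normal_pdf.
  - by move=> x _; rewrite lee_fin normal_pdf_ge0.
rewrite !scale//.
have mpdf (c m : R) : measurable_fun A (fun x => (c * normal_pdf m 1 x)%:E).
  apply/measurable_EFinP; apply: measurable_funM => //.
  by apply/measurable_funTS; exact: measurable_normal_pdf.
apply: ge0_le_integral => //=.
by move=> x _; rewrite lee_fin mulr_ge0// normal_pdf_ge0.
Qed.

(** By absolute continuity with respect to Lebesgue measure; it makes open and closed endpoints
    interchangeable below. *)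
Lemma gauss_set1 m t : gauss m [set t] = 0%E.
Proof.
have /null_content_dominatesP/(_ [set t]) := normal_prob_dominates m 1.
by apply=> //; exact: lebesgue_measure_set1.
Qed.

Lemma gauss_gt0 m (a b : R) : a < b -> (0 < gauss m `[a, b[%classic)%E.
Proof.
(* A positive lower bound for the density on the interval: [(x - m) ^+ 2] is at most its value at
   [a] when [x <= m] and at [b] otherwise, hence at most the sum of both. *)
move=> ab; pose c := normal_peak 1 * expR (- ((a - m) ^+ 2 + (b - m) ^+ 2) / 2).
have c0 : 0 < c by rewrite mulr_gt0 ?expR_gt0// normal_peak_gt0// oner_eq0.
apply: (@lt_le_trans _ _ (c%:E * lebesgue_measure `[a, b[%classic)%E).
  rewrite lebesgue_measure_itv/= lte_fin ab -EFinD -EFinM lte_fin.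
  by rewrite mulr_gt0// subr_gt0.
rewrite -integral_cst//; apply: ge0_le_integral => //=.
- by move=> x _; rewrite lee_fin ltW.
- exact: measurable_EFin_normal_pdf.
- move=> x; rewrite in_itv/= => /andP[ax xb].
  rewrite lee_fin normal_pdf1E ler_pM2l ?normal_peak_gt0 ?oner_eq0// ler_expR.
  rewrite ler_wpM2r ?invr_ge0// lerN2.
  have [xm|/ltW mx] := leP x m.
    apply: ler_wpDr; first exact: sqr_ge0.
    by rewrite -sqrrN -[leRHS]sqrrN ler_sqr ?nnegrE; lra.
  by apply: ler_wpDl; [exact: sqr_ge0|rewrite ler_sqr ?nnegrE; lra].
Qed.

Lemma PhiE t : (Phi t%:E)%:E = gauss 0 `]-oo, t]%classic.
Proof. by rewrite /= fineK// fin_num_measure. Qed.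

(** The substitution [x - m] turns the density centred at [m] into the standard one. *)
Lemma gauss_Nyc m t : gauss m `]-oo, t]%classic = (Phi (t - m)%:E)%:E.
Proof.
rewrite PhiE /gauss /= /normal_prob.
have dF x : derivable (fun y : R => y - m) x 1 by [].
have F'E : (fun y : R => y - m)^`()%classic = cst 1.
  apply/funext => x; rewrite derive1E deriveB// derive_id derive_cst.
  exact: subr0.
rewrite [RHS](@increasing_ge0_integration_by_substitutionNy _ (fun x => x - m)
  (normal_pdf 0 1) t).
- apply: eq_integral => x _.
  by rewrite F'E /= mulr1 [RHS]/= !normal_pdf1E subr0.
- by move=> x y _ _ xy; rewrite ltrD2r.
- by rewrite F'E => x _; exact: cvg_cst.
- by rewrite F'E; exact: is_cvg_cst.
- by rewrite F'E; exact: cvg_cst.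
- split => [x _|]; first exact: dF.
  apply: (@cvg_at_left_filter R R^o).
  by apply: cvgB; [exact: cvg_id|exact: cvg_cst].
- exact: cvg_addrr_Ny.
- apply: continuous_subspaceT; apply: continuous_normal_pdf; exact: oner_neq0.
- by move=> x _; exact: normal_pdf_ge0.
Qed.

Lemma fine_gauss_oy m t : fine (gauss m `]t, +oo[%classic) = 1 - Phi (t - m)%:E.
Proof. by rewrite -setCitvl probability_setC// gauss_Nyc. Qed.

Lemma fine_gaussU m A B : measurable A -> measurable B -> [disjoint A & B] ->
  fine (gauss m (A `|` B)) = fine (gauss m A) + fine (gauss m B).
Proof.
move=> mA mB AB; rewrite measureU//; last exact/disj_set2P.
by rewrite fineD// fin_num_measure.
Qed.

Lemma fine_gauss_cy m t : fine (gauss m `[t, +oo[%classic) = 1 - Phi (t - m)%:E.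
Proof.
rewrite -(@setU1itv _ _ _ t false)// fine_gaussU//.
- by rewrite gauss_set1 add0r fine_gauss_oy.
- by apply/disj_set2P; rewrite -subset0 => x /= [->]; rewrite in_itv/= ltxx.
Qed.

Lemma fine_gauss_co m (a b : R) : a <= b ->
  fine (gauss m `[a, b[%classic) = Phi (b - m)%:E - Phi (a - m)%:E.
Proof.
(* Adding the mass of the ray from [b] completes the interval to the ray from [a]. *)
move=> ab; apply/eqP; rewrite -(inj_eq (addIr (1 - Phi (b - m)%:E))); apply/eqP.
rewrite -fine_gauss_cy -fine_gaussU//; last first.
  apply/disj_set2P; rewrite -subset0 => x /= []; rewrite !in_itv/= andbT.
  by move=> /andP[_]; rewrite leNgt => ->.
rewrite -itv_bndbnd_setU// ?bnd_simp// !fine_gauss_cy.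
ring.
Qed.

Lemma fine_gauss_cc m (a b : R) : a <= b ->
  fine (gauss m `[a, b]%classic) = Phi (b - m)%:E - Phi (a - m)%:E.
Proof.
move=> ab; rewrite -(@setUitv1 _ _ _ b true)// fine_gaussU//.
- by rewrite gauss_set1 addr0 fine_gauss_co.
- apply/disj_set2P; rewrite -subset0 => x /= [] /[swap] ->.
  by rewrite in_itv/= ltxx andbF.
Qed.

Lemma Phi_lt (a b : R) : a < b -> Phi a%:E < Phi b%:E.
Proof.
move=> ab; rewrite -subr_gt0 -[a]subr0 -[b]subr0 -fine_gauss_co ?ltW//.
by rewrite fine_gt0// gauss_gt0// ltey_eq fin_num_measure.
Qed.

Lemma Phi_gt0 t : 0 < Phi t%:E.
Proof.
apply: le_lt_trans (Phi_lt (t - 1) t _); first by rewrite fine_ge0.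
by rewrite gtrBl.
Qed.

Lemma Phi_lt1 t : Phi t%:E < 1.
Proof.
apply: lt_le_trans (Phi_lt t (t + 1) _) _; first by rewrite ltrDl.
by rewrite -lee_fin PhiE probability_le1.
Qed.


(** The identity seen as a random variable under [gauss 0]: its distribution function is [Phi],
    which gives the limits at both infinities. *)
Let idTR : measurableTypeR R -> R := idfun.

#[local] HB.instance Definition _ :=
  @isMeasurableFun.Build _ _ _ _ idTR (@measurable_id _ _ setT).

Lemma cvg_Phi_Ny : Phi x%:E @[x --> -oo] --> (0 : R).
Proof.
exact/fine_cvg/(@cvg_cdfNy0 _ _ _ _ (idTR : {RV gauss (0 : R) >-> R})).
Qed.

Lemma cvg_Phi_y : Phi x%:E @[x --> +oo] --> (1 : R).
Proof.
exact/fine_cvg/(@cvg_cdfy1 _ _ _ _ (idTR : {RV gauss (0 : R) >-> R})).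
Qed.

(** The limits at infinity give [a] and [b] with [p] between their values; the intermediate value
    theorem concludes. *)
Lemma Phi_surj p : 0 < p < 1 -> exists t, Phi t%:E = p.
Proof.
move=> /andP[p0 p1].
have /filter_ex[a ap] : \forall x \near -oo, Phi x%:E < p.
  by apply: cvgr_lt p0; exact: cvg_Phi_Ny.
have /filter_ex[b pb] : \forall x \near +oo, p < Phi x%:E.
  by apply: cvgr_gt p1; exact: cvg_Phi_y.
have ab : a <= b.
  by rewrite leNgt; apply/negP => /Phi_lt; rewrite ltNge (ltW (lt_trans ap pb)).
(* Continuity comes from writing [Phi], up to the constant [Phi a], as the integral of the density
   from [a]. *)
pose F x := parameterized_integral lebesgue_measure a x (normal_pdf 0 1).
have FE x : a <= x -> F x = Phi x%:E - Phi a%:E.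
  by move=> ax; rewrite -[x in RHS]subr0 -[a in RHS]subr0 -fine_gauss_cc.
have cF : {within `[a, b], continuous F}.
  apply: parameterized_integral_continuous => //.
  by apply: integrableS (integrable_normal_pdf 0 1).
have [|t tab Ft] := IVT (v := p - Phi a%:E) ab cF.
  rewrite !FE// subrr ge_min le_max subr_ge0 (ltW ap)/=.
  by rewrite lerD2r (ltW pb) orbT.
exists t; move: Ft; rewrite FE ?(itvP tab)//; exact: addIr.
Qed.

Lemma Phi_inj (s t : R) : Phi s%:E = Phi t%:E -> s = t.
Proof.
move=> st; apply/eqP; rewrite eq_le !leNgt.
by apply/andP; split; apply/negP => /Phi_lt; rewrite st ltxx.
Qed.

(** The strict bounds on [Phi] exclude both infinite conventions, and injectivity determines the
    chosen preimage. *)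
Lemma Phi_invK (t : R) : Phi_inv (Phi t%:E) = t%:E.
Proof.
rewrite /Phi_inv gt_eqF ?Phi_gt0// lt_eqF ?Phi_lt1//; congr EFin.
by apply: xget_unique => // y /Phi_inj.
Qed.

End gaussian.

(** * Measurability with respect to the unit cells *)

Section coarse.
Context {R : realType}.
Local Notation cells := (unit_cells_algebra R).

(** The sets that do not cut [C] form a sigma-algebra. *)
Lemma sigma_algebra_atom (T : Type) (G : set (set T)) (C : set T) :
  (forall A, G A -> C `<=` A \/ C `<=` ~` A) ->
  forall A, <<s G >> A -> C `<=` A \/ C `<=` ~` A.
Proof.
move=> GC; apply: smallest_sub => //; split.
- by right=> x _ [].
- move=> A [CA|CA]; rewrite setTD; last by left.
  by right=> x /CA Ax; exact.
(* Either some member of the sequence contains [C], or all of them avoid it. *)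
- move=> F CF; have [[i CFi]|nCF] := pselect (exists i, C `<=` F i).
    by left=> x /CFi Fix; exists i.
  right=> x Cx [i _ Fix]; have [CFi|CFi] := CF i; first by apply: nCF; exists i.
  exact: CFi Fix.
Qed.

Definition unit_cell (k : int) : set (measurableTypeR R) :=
  `[k%:~R, (k + 1)%:~R[%classic.

Lemma unit_cell_inj (j k : int) (x : R) :
  unit_cell j x -> unit_cell k x -> j = k.
Proof.
rewrite /unit_cell/= !in_itv/= => /andP[jx xj] /andP[kx xk].
have := le_lt_trans jx xk; have := le_lt_trans kx xj.
rewrite !ltr_int !ltzD1 => kj jk.
by apply/eqP; rewrite eq_le jk kj.
Qed.

Lemma coarse_measurable_Borel (f : R -> R) :
  measurable_fun setT (f : g_sigma_algebraType cells -> R) ->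
  measurable_fun setT (f : measurableTypeR R -> R).
Proof.
move=> mf _ Y mY.
have cells_sub : <<s cells >> `<=` @measurable _ (measurableTypeR R).
  apply: smallest_sub; first exact: sigma_algebra_measurable.
  exact: (unit_cells_algebra_sub R).2.
exact: cells_sub (mf measurableT Y mY).
Qed.

(** The fibre of [f] over its value at [k] is measurable, hence does not cut the cell; it meets the
    cell at [k], so it contains it. *)
Lemma coarse_measurable_cst (f : R -> R) (k : int) :
  measurable_fun setT (f : g_sigma_algebraType cells -> R) ->
  forall x, unit_cell k x -> f x = f k%:~R.
Proof.
move=> mf x kx.
have mA : <<s cells >> (f @^-1` [set f k%:~R]).
  by have := mf measurableT _ (measurable_set1 (f k%:~R)); rewrite setTI.
have kk : unit_cell k k%:~R.
  by rewrite /unit_cell/= in_itv/= lexx ltr_int ltzD1 lexx.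
have [|/(_ _ kx)//|/(_ _ kk)/=] := sigma_algebra_atom _ _ (unit_cell k) _ _ mA;
  last by [].
(* Second use of the lemma: [cells] is itself generated by the intervals, so [<<s cells >>] is
   generated in two layers. *)
apply: sigma_algebra_atom => _ [n _ <-].
have [->|nk] := eqVneq n k; first by left.
by right=> y ky ny; move/eqP : nk; apply; exact: unit_cell_inj ny ky.
Qed.

Lemma cells_unit_cell k :
  measurable (unit_cell k : set (g_sigma_algebraType cells)).
Proof. by apply: sub_sigma_algebra; apply: sub_sigma_algebra; exists k. Qed.

Lemma cells_ray (k : int) :
  measurable (`[k%:~R, +oo[%classic : set (g_sigma_algebraType cells)).
Proof.
have -> : `[k%:~R, +oo[%classic = \bigcup_(n : nat) unit_cell (k + n%:Z).
  apply/seteqP; split=> [x|x [n _]]; rewrite /unit_cell/= !in_itv/= ?andbT.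
    (* The cell containing [x] is the one that starts at its floor. *)
    move=> kx; exists `|Num.floor x - k|%N => //=.
    have fk : k <= Num.floor x by rewrite floor_ge_int.
    rewrite in_itv/= gez0_abs ?subr_ge0// subrKC.
    by rewrite floor_le floorD1_gt.
  by move=> /andP[+ _]; apply: le_trans; rewrite ler_int lerDl.
by apply: bigcupT_measurable => n; exact: cells_unit_cell.
Qed.

Lemma fine_gauss_unit_cell (m : R) (k : int) :
  fine (gauss m (unit_cell k)) = Phi ((k + 1)%:~R - m)%:E - Phi (k%:~R - m)%:E.
Proof. by rewrite fine_gauss_co// ler_int lerDl. Qed.

End coarse.

(** * The Gaussian trade-off functions, fine and coarse *)

Section gaussian_tradeoff.
Context {R : realType} (mu : R) (mu_gt0 : 0 < mu).
Local Notation P0 := (gauss (0 : R)).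
Local Notation Pmu := (gauss mu).
Local Notation L := (likelihood_ratio mu).
Local Notation cells := (unit_cells_algebra R).
Local Notation T := (tradeoff P0 Pmu).
Local Notation T_G := (coarse_tradeoff cells P0 Pmu).

(** With its mirror image below, reduces the set comparisons of [neyman_pearson] to pointwise bounds
    on the likelihood ratio. *)
Lemma le_scaled_gauss (c : R) A : 0 <= c -> measurable A ->
  (forall x, A x -> c <= L x) -> (c%:E * P0 A <= Pmu A)%E.
Proof.
move=> c0 mA cL; rewrite -[leRHS]mul1e; apply: le_gauss => // x Ax.
by rewrite mul1r (normal_pdf_likelihood_ratio mu) ler_wpM2r ?normal_pdf_ge0 ?cL.
Qed.

Lemma ge_scaled_gauss (c : R) A : 0 <= c -> measurable A ->
  (forall x, A x -> L x <= c) -> (Pmu A <= c%:E * P0 A)%E.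
Proof.
move=> c0 mA cL; rewrite -[leLHS]mul1e; apply: le_gauss => // x Ax.
by rewrite mul1r (normal_pdf_likelihood_ratio mu) ler_wpM2r ?normal_pdf_ge0 ?cL.
Qed.

(** The half-line beyond [t] has exactly this level, so [W] is empty and the critical ratio is
    [L t]. *)
Lemma tradeoff_Phi t : T (1 - Phi t%:E) = (Phi (t - mu)%:E)%:E.
Proof.
have L0 := ltW (likelihood_ratio_gt0 mu t).
pose U : set (measurableTypeR R) := `]t, +oo[%classic.
have PU : fine (P0 U) = 1 - Phi t%:E by rewrite fine_gauss_oy subr0.
have QU : fine (Pmu U) = 1 - Phi (t - mu)%:E by exact: fine_gauss_oy.
have -> : 1 - Phi t%:E = fine (P0 U) + 0 * fine (P0 set0).
  by rewrite mul0r addr0 PU.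
have -> : Phi (t - mu)%:E = 1 - fine (Pmu U) - 0 * fine (Pmu set0).
  by rewrite mul0r subr0 QU subKr.
apply: (@neyman_pearson _ _ _ _ P0 Pmu U set0 (NngNum L0) 0) => //.
- exact: measurable_itv.
- by apply/disj_set2P; rewrite setI0.
- by rewrite lexx ler01.
- move=> A mA At; apply: le_scaled_gauss => // x /At /=.
  by rewrite /U/= in_itv/= andbT le_likelihood_ratio// => /ltW.
- move=> A mA; rewrite setU0 => At; apply: ge_scaled_gauss => // x /At /=.
  by rewrite /U/= in_itv/= andbT => /negP; rewrite -leNgt le_likelihood_ratio.
- by rewrite !measure0 mulr0.
- by move=> phi mphi; split => //; exists 0.
- apply: measurable_funD.
    by apply: measurable_indic; exact: measurable_itv.
  by apply: measurable_funM => //; exact: measurable_indic.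
Qed.

(** No finite threshold has level 0, so the value is reached as a limit: by antitonicity it
    dominates the values at all positive levels, which come arbitrarily close to 1. *)
Lemma tradeoff0 : T 0 = 1%E.
Proof.
apply/eqP; rewrite eq_le; apply/andP; split.
  by apply: tradeoff_over_le1 => //; exact: measurable_cst.
apply/lee_subgt0Pr => e e0.
have [e1|e1] := leP 1 e.
  apply: (@le_trans _ _ 0%E); first by rewrite -EFinB lee_fin subr_le0.
  apply: le_ereal_inf_tmp => _ [phi [_ phi01 _] <-].
  by apply: expectation_ge0 => x; rewrite subr_ge0; case/andP: (phi01 x).
have [t Pt] : exists t, Phi t%:E = 1 - e.
  by apply: Phi_surj; rewrite subr_gt0 e1 gtrBl.
(* The shift by [mu] makes the trade-off value at this threshold equal to [Phi t], that is
   [1 - e]. *)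
have := tradeoff_Phi (t + mu); rewrite addrK Pt EFinB => <-.
by apply: tradeoff_over_antitone; rewrite subr_ge0 ltW// Phi_lt1.
Qed.

(** Rejecting everywhere is optimal: [U] is the whole line and the critical ratio is 0. *)
Lemma tradeoff1 : T 1 = 0%E.
Proof.
have := @neyman_pearson _ _ _ [set phi : measurableTypeR R -> R |
  measurable_fun setT phi] P0 Pmu setT set0 (NngNum (lexx 0)) 0.
rewrite !probability_setT mul0r addr0 mul0r subr0 subrr; apply => //.
- by apply/disj_set2P; rewrite setI0.
- by rewrite lexx ler01.
- by move=> A mA _; rewrite mul0e measure_ge0.
- by move=> A mA; rewrite setU0 setCT subset0 => ->; rewrite !measure0 mule0.
- by rewrite measure0.
- by move=> phi mphi; split => //; exists 0.
- apply: measurable_funD; first exact: measurable_indic.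
  by apply: measurable_funM => //; exact: measurable_indic.
Qed.

Lemma tradeoff_Phi_inv alpha : 0 <= alpha <= 1 ->
  T alpha = (Phi (Phi_inv (1 - alpha) - mu%:E)%E)%:E.
Proof.
move=> /andP[]; rewrite le_eqVlt => /predU1P[<- _|alpha0].
  by rewrite subr0 /Phi_inv oner_eq0 eqxx tradeoff0.
rewrite le_eqVlt => /predU1P[->|alpha1].
  by rewrite subrr /Phi_inv eqxx tradeoff1.
have [t Pt] : exists t, Phi t%:E = 1 - alpha.
  by apply: Phi_surj; rewrite subr_gt0 alpha1 gtrBl.
by rewrite -[alpha in LHS](subKr 1) -Pt Phi_invK tradeoff_Phi.
Qed.

Lemma coarse_tradeoff_mix (k : int) (l : R) : 0 <= l <= 1 ->
  T_G (1 - Phi (k + 1)%:~R%:E + l * (Phi (k + 1)%:~R%:E - Phi k%:~R%:E)) =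
  (Phi ((k + 1)%:~R - mu)%:E -
   l * (Phi ((k + 1)%:~R - mu)%:E - Phi (k%:~R - mu)%:E))%:E.
Proof.
move=> l01; have mW : measurable (unit_cell k : set (measurableTypeR R)).
  exact: measurable_itv.
have kk1 : (k%:~R : R) < (k + 1)%:~R by rewrite ltr_int ltrDl.
pose p := fine (P0 (unit_cell k)); pose q := fine (Pmu (unit_cell k)).
have p0 : 0 < p by rewrite /p fine_gauss_unit_cell !subr0 subr_gt0 Phi_lt.
have q0 : 0 <= q by rewrite fine_ge0.
(* The ratio [q / p] is the mean of [L] over the cell, so it lies between the values of [L] at the
   two ends. *)
have qp : L k%:~R * p <= q <= L (k + 1)%:~R * p.
  apply/andP; split; rewrite -lee_fin EFinM !fineK ?fin_num_measure//.
    apply: le_scaled_gauss => //; first exact/ltW/likelihood_ratio_gt0.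
    by move=> x; rewrite /unit_cell/= in_itv/= le_likelihood_ratio// => /andP[].
  apply: ge_scaled_gauss => //; first exact/ltW/likelihood_ratio_gt0.
  move=> x; rewrite /unit_cell/= in_itv/= le_likelihood_ratio//.
  by move=> /andP[_ /ltW].
have c0 : 0 <= q / p by exact: divr_ge0 q0 (ltW p0).
have between (x y z t : R) : 0 < x -> y * x <= z <= t * x -> y <= z / x <= t.
  by move=> x0; rewrite ler_pdivlMr// ler_pdivrMr.
have /andP[Lkc cLk1] := between _ _ _ _ p0 qp.
pose U : set (measurableTypeR R) := `[(k + 1)%:~R, +oo[%classic.
have PU : fine (P0 U) = 1 - Phi (k + 1)%:~R%:E by rewrite fine_gauss_cy subr0.
have QU : fine (Pmu U) = 1 - Phi ((k + 1)%:~R - mu)%:E by exact: fine_gauss_cy.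
have PW : p = Phi (k + 1)%:~R%:E - Phi k%:~R%:E.
  by rewrite /p fine_gauss_unit_cell !subr0.
have QW : q = Phi ((k + 1)%:~R - mu)%:E - Phi (k%:~R - mu)%:E.
  exact: fine_gauss_unit_cell.
rewrite -PW -QW -PU -[Phi ((k + 1)%:~R - mu)%:E](subKr 1) -QU.
apply: (@neyman_pearson _ _ _ _ P0 Pmu U (unit_cell k) (NngNum c0) l) => //.
- exact: measurable_itv.
- apply/disj_set2P; rewrite -subset0 => x /=.
  rewrite /U /unit_cell/= !in_itv/= andbT => -[+ /andP[_]].
  by rewrite leNgt => /negP.
- move=> A mA Ak; apply: le_scaled_gauss => // x /Ak.
  rewrite /U/= in_itv/= andbT => kx; apply: le_trans cLk1 _.
  by rewrite le_likelihood_ratio.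
(* A point outside [U] and the cell is at most [k], where [L] is at most [L k], hence at most
   [q / p]. *)
- move=> A mA Ak; apply: ge_scaled_gauss => // x /Ak Akx.
  apply: le_trans Lkc; rewrite le_likelihood_ratio// leNgt; apply/negP => kx.
  apply: Akx; rewrite /U /unit_cell/= !in_itv/= andbT (ltW kx)/=.
  by have [|] := leP (k + 1)%:~R x; [left|right].
- by apply/esym/divfK; rewrite gt_eqF.
- move=> phi mphi; split; first exact: coarse_measurable_Borel.
  by exists (phi k%:~R); exact: coarse_measurable_cst.
- apply: measurable_funD; first by apply: measurable_indic; exact: cells_ray.
  apply: measurable_funM => //.
  by apply: measurable_indic; exact: cells_unit_cell.
Qed.

Lemma coarse_tradeoff_Phi (k : int) :
  T_G (1 - Phi k%:~R%:E) = (Phi (k%:~R - mu)%:E)%:E.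
Proof.
(* The ray from [k] starts at the right end of cell [k - 1], with randomization 0. *)
have := @coarse_tradeoff_mix (k - 1) 0.
by rewrite subrK !mul0r addr0 subr0; apply; rewrite lexx ler01.
Qed.

End gaussian_tradeoff.

Theorem proposition2 (R : realType) (mu : R) (mu_gt0 : 0 < mu) :
  let P_0 := gauss (0 : R) in
  let P_mu := gauss mu in
  let T := tradeoff P_0 P_mu in
  let T_G := coarse_tradeoff (unit_cells_algebra R) P_0 P_mu in
  let a := fun k : int => 1 - Phi (k%:~R)%:E : R in
  let q := fun k : int =>
    Phi ((k + 1)%:~R - mu)%:E - Phi (k%:~R - mu)%:E : R in
  (forall alpha : R, 0 <= alpha <= 1 ->
     T alpha = (Phi (Phi_inv (1 - alpha) - mu%:E)%E)%:E) /\
  (forall k : int,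
     T_G (a k) = (Phi (Phi_inv (1 - a k) - mu%:E)%E)%:E) /\
  (forall (k : int) (alpha : R), a (k + 1) <= alpha <= a k ->
     let lambda := (alpha - a (k + 1)) / (a k - a (k + 1)) in
     T_G alpha = (T_G (a (k + 1)%R) - (lambda * q k)%:E)%E).
Proof.
move=> P_0 P_mu T T_G a q; split; [|split].
- exact: tradeoff_Phi_inv.
- by move=> k; rewrite /a subKr Phi_invK; exact: coarse_tradeoff_Phi.
move=> k alpha /andP[alphak1 alphak] lambda.
have pE : a k - a (k + 1) = Phi (k + 1)%:~R%:E - Phi k%:~R%:E.
  by rewrite /a; ring.
have p0 : 0 < a k - a (k + 1) by rewrite pE subr_gt0 Phi_lt// ltr_int ltrDl.
have l01 : 0 <= lambda <= 1.
  apply/andP; split; first by apply: divr_ge0 (ltW p0); rewrite subr_ge0.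
  by rewrite /lambda ler_pdivrMr// mul1r lerD2r.
(* [lambda] is the rejection probability on the cell, whose mass under [P_0] is [a k - a (k + 1)];
   its positivity makes the division genuine. *)
have -> : alpha = a (k + 1) + lambda * (a k - a (k + 1)).
  by rewrite /lambda divfK ?gt_eqF// subrKC.
rewrite pE; apply: etrans (coarse_tradeoff_mix _ mu_gt0 _ _ l01) _.
by rewrite /T_G (coarse_tradeoff_Phi _ mu_gt0).
Qed.
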